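(* Let $A, B, C \subseteq \mathbb{R}$ and let $f: A\to\mathbb{R}$, $g: B\to\mathbb{R}$, $h: C\to\mathbb{R}$ be polynomial or rational functions. Consider the equation $\sqrt{f(x)}+\sqrt{g(x)}=\sqrt{h(x)}$ in the real unknown $x\in A\cap B\cap C$. Define $$S_0 = \{ x\in A\cap B\cap C \mid 4f(x)g(x) = [h(x)-f(x)-g(x)]^2\},$$ $$A_1 = \{ x\in A\cap B\cap C \mid f(x)\geq 0 \text{ and } g(x)\geq 0 \text{ and } h(x)\geq 0 \},$$ $$A_2 = \{ x\in A\cap B\cap C \mid h(x)-f(x)-g(x) \geq 0 \},$$ $$A_3 = \{ x\in A\cap B\cap C \mid f(x)\leq 0 \text{ and } g(x)\leq 0 \text{ and } h(x)\leq 0 \},$$ $$A_4 = \{ x\in A\cap B\cap C \mid h(x)-f(x)-g(x) \leq 0 \}.$$ Then the set $S_1$ of all strong solutions of the equation is $$S_1 = S_0 \cap A_1 \cap A_2,$$ and the set $S_2$ of all formal solutions of the equation is $$S_2 = (S_0 \cap A_1 \cap A_2)\cup (S_0 \cap A_3 \cap A_4).$$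
   Context: Square root convention: for a real number $a\ge 0$, $\sqrt{a}$ is the unique nonnegative real square root; for a real number $a<0$, $\sqrt{a}=i\sqrt{-a}$, which is purely imaginary with positive imaginary part. A formal solution of an equation involving square roots is a real number $x$ (in the common domain $A\cap B\cap C$ of the functions appearing in it) that satisfies the equation as an equality of complex numbers, where the radicals are allowed to evaluate to imaginary numbers under the convention above. A strong solution is a real number $x$ in this common domain that satisfies the equation and for which every expression appearing under a radical sign in the original equation (here $f(x)$, $g(x)$ and $h(x)$) is nonnegative. *)

(* Defs.v *)
From mathcomp Require Import all_boot all_order all_algebra.
From mathcomp Require Import classical_sets reals.
From mathcomp Require Import complex.

Set Implicit Arguments.
Unset Strict Implicit.
Unset Printing Implicit Defensive.

Import Order.TTheory GRing.Theory Num.Theory.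

Local Open Scope classical_set_scope.
Local Open Scope ring_scope.
Local Open Scope complex_scope.

(* A real function on a subset A of R is represented by a total function
   R -> R whose values outside A are never used. *)

Definition polynomial_on (R : realType) (A : set R) (f : R -> R) : Prop :=
  exists p : {poly R}, forall x, A x -> f x = p.[x].

Definition rational_on (R : realType) (A : set R) (f : R -> R) : Prop :=
  exists p q : {poly R}, forall x, A x -> q.[x] != 0 /\ f x = p.[x] / q.[x].

(* [sqrtc] of the library takes complex arguments; here the argument is real
   and the two branches of the convention are spelled out. [Num.sqrt] is the
   nonnegative real square root of a nonnegative real, and ['i%C] is the pair
   (0, 1), not the abstract ['i] of ring_scope. *)
Definition csqrt (R : realType) (a : R) : R[i] :=
  if 0 <= a then (Num.sqrt a)%:C else 'i%C * (Num.sqrt (- a))%:C.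

Definition formal_solution (R : realType) (A B C : set R) (f g h : R -> R)
    (x : R) : Prop :=
  (A `&` B `&` C) x /\ csqrt (f x) + csqrt (g x) = csqrt (h x).

Definition strong_solution (R : realType) (A B C : set R) (f g h : R -> R)
    (x : R) : Prop :=
  [/\ (A `&` B `&` C) x, csqrt (f x) + csqrt (g x) = csqrt (h x)
    & [/\ 0 <= f x, 0 <= g x & 0 <= h x]].

(* Main.v *)
Require Import Defs.
From mathcomp Require Import all_boot all_order all_algebra.
From mathcomp Require Import classical_sets reals.
From mathcomp Require Import complex ring.

(** Separating real and imaginary parts turns the complex equation into two
    real ones.  For every real [a] the principal square root is
    [Num.sqrt a + i * Num.sqrt (- a)], because [Num.sqrt] vanishes on negative
    numbers; so [csqrt a + csqrt b = csqrt c] says that the real square roots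
    add up both for [a, b, c] and for [- a, - b, - c] ([csqrt_addP]).

    If [0 <= c], the second equation writes 0 as a sum of two nonnegative
    numbers, which forces [0 <= a] and [0 <= b]; dually, [c <= 0] forces
    [a <= 0] and [b <= 0].  Hence a formal solution has its three radicands all
    nonnegative or all nonpositive ([csqrt_add_same_sign]).
    In either case one of the two real equations is trivial, and the other is
    settled by squaring twice ([sqrt_addP]): both sides being nonnegative,
    squaring loses nothing provided that the sign of
    [c - a - b] = 2 * sqrt (a * b) is recorded.  Passing to opposites leaves the
    polynomial equation unchanged and reverses that sign, whence the
    conditions [A2] and [A4]. *)

Set Implicit Arguments.
Unset Strict Implicit.
Unset Printing Implicit Defensive.

Import Order.TTheory GRing.Theory Num.Theory.

Local Open Scope classical_set_scope.
Local Open Scope ring_scope.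

Lemma csqrtE (R : realType) (a : R) :
  csqrt a = Complex (Num.sqrt a) (Num.sqrt (- a)).
Proof.
rewrite /csqrt; case: (leP 0 a) => [a_ge0|a_lt0].
  by rewrite (ler0_sqrtr (_ : - a <= 0)) ?oppr_le0.
rewrite (ler0_sqrtr (ltW a_lt0)).
by apply/eqP; rewrite eq_complex /= !mul0r !mul1r subr0 add0r !eqxx.
Qed.

Lemma csqrt_addP (R : realType) (a b c : R) :
  csqrt a + csqrt b = csqrt c <->
  Num.sqrt a + Num.sqrt b = Num.sqrt c /\
  Num.sqrt (- a) + Num.sqrt (- b) = Num.sqrt (- c).
Proof.
rewrite !csqrtE; split=> [[re_eq im_eq] // | [re_eq im_eq]].
by apply/eqP; rewrite eq_complex /= re_eq im_eq !eqxx.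
Qed.

Lemma sqrt_add_eq0 (R : rcfType) (a b : R) :
  Num.sqrt a + Num.sqrt b = 0 <-> a <= 0 /\ b <= 0.
Proof.
rewrite -!sqrtr_eq0; split=> [/eqP|[/eqP -> /eqP ->]]; last exact: addr0.
by rewrite paddr_eq0 ?sqrtr_ge0 // => /andP[].
Qed.

(** Write [s], [t], [u] for the three roots.  As [s + t] and [u] are
    nonnegative, [s + t = u] amounts to [2 * s * t = u ^+ 2 - s ^+ 2 - t ^+ 2];
    squaring again gives the polynomial equation, and this second step is
    reversible exactly when the right-hand side is nonnegative. *)
Lemma sqrt_addP (R : rcfType) (a b c : R) :
  0 <= a -> 0 <= b -> 0 <= c ->
  Num.sqrt a + Num.sqrt b = Num.sqrt c <->
  4 * a * b = (c - a - b) ^+ 2 /\ 0 <= c - a - b.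
Proof.
move=> /sqr_sqrtr; set s := Num.sqrt a => <-.
move=> /sqr_sqrtr; set t := Num.sqrt b => <-.
move=> /sqr_sqrtr; set u := Num.sqrt c => <-.
have s_ge0 : 0 <= s by exact: sqrtr_ge0.
have t_ge0 : 0 <= t by exact: sqrtr_ge0.
have u_ge0 : 0 <= u by exact: sqrtr_ge0.
have st_ge0 : 0 <= 2 * s * t by rewrite !mulr_ge0.
split=> [<- | [sq_eq diff_ge0]].
  have -> : (s + t) ^+ 2 - s ^+ 2 - t ^+ 2 = 2 * s * t by ring.
  by split=> //; ring.
have diffE : 2 * s * t = u ^+ 2 - s ^+ 2 - t ^+ 2.
  by apply/eqP; rewrite -(eqrXn2 (n := 2)) // -sq_eq; apply/eqP; ring.
apply/eqP; rewrite -(eqrXn2 (n := 2)) ?addr_ge0 //; apply/eqP.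
have -> : (s + t) ^+ 2 = s ^+ 2 + t ^+ 2 + 2 * s * t by ring.
by rewrite diffE; ring.
Qed.

Lemma csqrt_add_ge0P (R : realType) (a b c : R) :
  0 <= a -> 0 <= b -> 0 <= c ->
  csqrt a + csqrt b = csqrt c <->
  4 * a * b = (c - a - b) ^+ 2 /\ 0 <= c - a - b.
Proof.
move=> a_ge0 b_ge0 c_ge0; rewrite -sqrt_addP // csqrt_addP.
split=> [[] // | ->]; split=> //.
by rewrite !ler0_sqrtr ?oppr_le0 // addr0.
Qed.

(** Only the imaginary parts survive here, so this is the nonnegative criterion
    for the opposite radicands. *)
Lemma csqrt_add_le0P (R : realType) (a b c : R) :
  a <= 0 -> b <= 0 -> c <= 0 ->
  csqrt a + csqrt b = csqrt c <->
  4 * a * b = (c - a - b) ^+ 2 /\ c - a - b <= 0.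
Proof.
move=> a_le0 b_le0 c_le0.
have -> : 4 * a * b = 4 * - a * - b by ring.
have -> : (c - a - b) ^+ 2 = (- c - - a - - b) ^+ 2 by ring.
have -> : (c - a - b <= 0) = (0 <= - c - - a - - b).
  by rewrite -oppr_ge0; congr (0 <= _); ring.
rewrite -sqrt_addP ?oppr_ge0 // csqrt_addP.
split=> [[] // | ->]; split=> //.
by rewrite !ler0_sqrtr // addr0.
Qed.

(** The sign of [c] kills one of the two parts of the right-hand side, and that
    part of each term on the left is nonnegative, hence zero as well. *)
Lemma csqrt_add_same_sign (R : realType) (a b c : R) :
  csqrt a + csqrt b = csqrt c ->
  [/\ 0 <= a, 0 <= b & 0 <= c] \/ [/\ a <= 0, b <= 0 & c <= 0].
Proof.
move=> /csqrt_addP[re_eq im_eq]; case: (leP 0 c) => [c_ge0 | /ltW c_le0].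
- move: im_eq; rewrite (ler0_sqrtr (_ : - c <= 0)) ?oppr_le0 //.
  by move=> /sqrt_add_eq0; rewrite !oppr_le0 => -[a_ge0 b_ge0]; left.
- move: re_eq; rewrite (ler0_sqrtr c_le0).
  by move=> /sqrt_add_eq0[a_le0 b_le0]; right.
Qed.

Theorem proposition3p1 (R : realType) (A B C : set R) (f g h : R -> R)
    (hf : polynomial_on A f \/ rational_on A f)
    (hg : polynomial_on B g \/ rational_on B g)
    (hh : polynomial_on C h \/ rational_on C h) :
  let D := A `&` B `&` C in
  let S0 := [set x | D x /\ 4 * f x * g x = (h x - f x - g x) ^+ 2] in
  let A1 := [set x | D x /\ [/\ 0 <= f x, 0 <= g x & 0 <= h x]] in
  let A2 := [set x | D x /\ 0 <= h x - f x - g x] in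
  let A3 := [set x | D x /\ [/\ f x <= 0, g x <= 0 & h x <= 0]] in
  let A4 := [set x | D x /\ h x - f x - g x <= 0] in
  let S1 := [set x | strong_solution A B C f g h x] in
  let S2 := [set x | formal_solution A B C f g h x] in
  S1 = S0 `&` A1 `&` A2 /\
  S2 = (S0 `&` A1 `&` A2) `|` (S0 `&` A3 `&` A4).
Proof.
move=> D S0 A1 A2 A3 A4 S1 S2; split; apply/seteqP; split=> x.
- move=> [Dx eqx [f0 g0 h0]].
  by have [sq ge] := (csqrt_add_ge0P f0 g0 h0).1 eqx.
- move=> [[[Dx sq] [_ [f0 g0 h0]]] [_ ge]].
  by split=> //; apply/csqrt_add_ge0P.
- move=> [Dx eqx]; case: (csqrt_add_same_sign eqx) => -[f0 g0 h0].
  + by have [sq ge] := (csqrt_add_ge0P f0 g0 h0).1 eqx; left.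
  + by have [sq le] := (csqrt_add_le0P f0 g0 h0).1 eqx; right.
- move=> [[[[Dx sq] [_ [f0 g0 h0]]] [_ sgn]] | [[[Dx sq] [_ [f0 g0 h0]]] [_ sgn]]].
  + by split=> //; apply/csqrt_add_ge0P.
  + by split=> //; apply/csqrt_add_le0P.
Qed.
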